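(* Let $\mathbb{F}$ be a field of characteristic zero and let $A$ be an Artinian Gorenstein algebra over $\mathbb{F}$ with $\dim_{\mathbb{F}}A>2$, identity element $\mathbf{1}$ and maximal ideal $\mathfrak{m}$. Let $\nu$ be the nil-index of $\mathfrak{m}$ and let $k:=\dim_{\mathbb{F}}\mathfrak{m}/\mathfrak{m}^2$. Let $\Pi\subset\mathfrak{m}$ be any hyperplane (linear subspace of codimension one) in $\mathfrak{m}$ complementary to $\mathrm{Ann}(\mathfrak{m})=\mathfrak{m}^{\nu}$, let $\omega:A\to\mathbb{F}$ be any linear form with $\ker\omega=\langle\Pi,\mathbf{1}\rangle$, and let $P:\Pi\to\mathbb{F}$ be the corresponding nil-polynomial, $$P(x)=\omega\left(\sum_{s=2}^{\nu}\frac{1}{s!}x^s\right),\quad x\in\Pi.$$ Let $L\subset\Pi$ be any $k$-dimensional subspace that is a complement to $\mathfrak{m}^2$ in $\mathfrak{m}$, let $e_1,\dots,e_k$ be any basis of $L$, and let $R\in\mathbb{F}[y_1,\dots,y_k]$ be the restriction of $P$ to $L$ written in the coordinates $y_1,\dots,y_k$ with respect to this basis, i.e. $$R(y_1,\dots,y_k)=\sum_{j=0}^{\nu}\frac{1}{j!}\,\omega\Bigl((y_1e_1+\dots+y_ke_k)^j\Bigr).$$ Let $I:=\{f\in\mathbb{F}[x_1,\dots,x_k]: f(e_1,\dots,e_k)=0\}$ be the ideal of all relations among $e_1,\dots,e_k$. Then $R$ is an inverse system for the quotient $\mathbb{F}[x_1,\dots,x_k]/I$; that is, $R$ is a polynomial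 of degree $\nu$ and $$\left\{f\in\mathbb{F}[x_1,\dots,x_k]: f\left(\frac{\partial}{\partial y_1},\dots,\frac{\partial}{\partial y_k}\right)(R)=0\right\}=I.$$
   Context: A (unital) local commutative associative algebra $A$ over $\mathbb{F}$ of finite vector space dimension greater than $1$, with maximal ideal $\mathfrak{m}$, is called (Artinian) Gorenstein if the annihilator $\mathrm{Ann}(\mathfrak{m}):=\{x\in\mathfrak{m}: x\mathfrak{m}=0\}$ of the maximal ideal is $1$-dimensional over $\mathbb{F}$. (In particular $A=\mathbb{F}\mathbf{1}\oplus\mathfrak{m}$.) The ideal $\mathfrak{m}$ is nilpotent; its nil-index $\nu$ is the largest integer $\mu$ for which $\mathfrak{m}^{\mu}\ne 0$. When $\dim_{\mathbb{F}}A>2$ one has $\nu\ge 2$, and $\mathrm{Ann}(\mathfrak{m})=\mathfrak{m}^{\nu}$. $\langle\,\cdot\,\rangle$ denotes linear span over $\mathbb{F}$. The convention $x^0:=\mathbf{1}$ is used for $x\in\mathfrak{m}$. A nil-polynomial on a hyperplane $\Pi\subset\mathfrak{m}$ complementary to $\mathrm{Ann}(\mathfrak{m})$ is an $\mathbb{F}$-valued polynomial $P$ on $\Pi$ of the form $P=\omega\circ\exp|_{\Pi}$, where $\exp(x)=\sum_{s\ge 0}\frac{1}{s!}x^s$ (a finite sum for $x\in\mathfrak{m}$) and $\omega:A\to\mathbb{F}$ is a linear form with $\ker\omega=\langle\Pi,\mathbf{1}\rangle$. Since $\omega$ vanishes on $\mathbf{1}$ and on $\Pi$, the terms $s=0,1$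 contribute zero. The number $k=\dim_{\mathbb{F}}\mathfrak{m}/\mathfrak{m}^2\ge 1$ is the embedding dimension of $A$. Since $\dim_{\mathbb{F}}A>2$, the hyperplane $\Pi$ contains a $k$-dimensional complement to $\mathfrak{m}^2$ in $\mathfrak{m}$. The elements $e_1,\dots,e_k$ of a basis of such a complement generate $A$ as an algebra, so $A\cong\mathbb{F}[x_1,\dots,x_k]/I$, where $I$ is the ideal of polynomials $f$ with $f(e_1,\dots,e_k)=0$. For $g\in\mathbb{F}[y_1,\dots,y_k]$, its annihilator is $\mathrm{Ann}(g):=\{f\in\mathbb{F}[x_1,\dots,x_k]: f(\partial/\partial y_1,\dots,\partial/\partial y_k)(g)=0\}$. A polynomial $g\in\mathbb{F}[y_1,\dots,y_k]$ of degree $\nu$ with $\mathrm{Ann}(g)=I$ is called a (Macaulay) inverse system for the Gorenstein quotient $\mathbb{F}[x_1,\dots,x_k]/I$. *)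

(* Defs.v *)
From HB Require Import structures.
From mathcomp Require Import all_boot all_order all_algebra all_field.
From mathcomp Require Import mpoly.

Set Implicit Arguments.
Unset Strict Implicit.
Unset Printing Implicit Defensive.

Import GRing.Theory.
Local Open Scope ring_scope.

Section Algebra.
Variables (F : fieldType) (A : falgType F).
Implicit Types (m U V W : {vspace A}) (x : A).

(* Ideals of a unital F-algebra are F-subspaces, so {vspace A} loses nothing.
   The definition is one-sided; it is used for commutative A only. *)
Definition is_ideal U : Prop := ({:A} * U <= U)%VS.

Definition maximal_ideal m : Prop :=
  [/\ is_ideal m, m <> {:A}%VS
    & forall U, is_ideal U -> (m <= U)%VS -> U = m \/ U = {:A}%VS].

Definition local_with m : Prop :=
  maximal_ideal m /\ (forall m', maximal_ideal m' -> m' = m).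

(* Ann(m) = {x in m | x m = 0}, see annihilatorP. *)
Definition annihilator m : {vspace A} :=
  (m :&: \bigcap_(i < \dim m) lker (amulr (vbasis m)`_i))%VS.

Lemma annihilatorP m x :
  reflect (x \in m /\ forall y, y \in m -> x * y = 0) (x \in annihilator m).
Proof.
rewrite memv_cap; apply: (iffP andP) => -[xm xA]; split=> //; last first.
  rewrite memvE; apply/subv_bigcapP => i _; rewrite -memvE memv_ker lfunE /=.
  by rewrite xA ?vbasis_mem ?mem_nth ?size_tuple.
move=> y /coord_vbasis ->; rewrite mulr_sumr big1 // => i _.
move: xA; rewrite memvE => /subv_bigcapP/(_ i isT).
by rewrite -memvE memv_ker lfunE /= -scalerAr => /eqP ->; rewrite scaler0.
Qed.

Definition gorenstein m : Prop :=
  [/\ commutative (@GRing.mul A), (1 < \dim {:A})%N, local_with m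
    & \dim (annihilator m) = 1%N].

Definition nil_index m (nu : nat) : Prop :=
  (m ^+ nu != 0)%VS /\ (forall mu : nat, (m ^+ mu != 0)%VS -> (mu <= nu)%N).

(* dim m / m^2, where m^2 is contained in the ideal m *)
Definition embedding_dim m : nat := \dim m - \dim (m ^+ 2)%VS.

(* V is the internal direct sum of U and W *)
Definition complementary_in V U W : Prop :=
  (U + W = V)%VS /\ (U :&: W = 0)%VS.

(* The terms s = 0, 1 of omega (exp x) vanish on Pi, see nilpolynomialE. *)
Definition nilpolynomial (omega : 'Hom(A, F^o)) (nu : nat) x : F :=
  omega (\sum_(2 <= s < nu.+1) (s`!%:R)^-1 *: x ^+ s).

Lemma nilpolynomialE (omega : 'Hom(A, F^o)) (Pi : {vspace A}) nu x :
  lker omega = (Pi + 1)%VS -> x \in Pi ->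
  nilpolynomial omega nu x = \sum_(s < nu.+1) (s`!%:R)^-1 * omega (x ^+ s).
Proof.
move=> kerE xPi.
have ker_omega y : y \in (Pi + 1)%VS -> omega y = 0.
  by rewrite -kerE memv_ker => /eqP.
have omega1 : omega 1 = 0.
  by apply/ker_omega/(subvP (addvSr Pi _))/memv_line.
have omegax : omega x = 0.
  by apply/ker_omega/(subvP (addvSl Pi _)).
rewrite /nilpolynomial big_geq_mkord raddf_sum [LHS]big_mkcond /=.
apply: eq_bigr => -[[|[|s]] ?] _ /=; last by rewrite linearZ.
  by rewrite expr0 omega1 mulr0.
by rewrite expr1 omegax mulr0.
Qed.

Definition lin_comb k (e : k.-tuple A) (y : 'I_k -> F) : A :=
  \sum_(i < k) y i *: tnth e i.

(* R is P in the coordinates given by e. Over an infinite field R is determined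
   by its values; for P = nilpolynomial omega nu existence is
   nilpolynomial_coordinates below. *)
Definition in_coordinates (P : A -> F) k (e : k.-tuple A)
    (R : {mpoly F[k]}) : Prop :=
  forall y : 'I_k -> F, R.@[y] = P (lin_comb e y).

Lemma nilpolynomial_coordinates (omega : 'Hom(A, F^o)) nu k (e : k.-tuple A) :
  exists R, in_coordinates (nilpolynomial omega nu) e R.
Proof.
have powE s : forall phi : 'Hom(A, F^o), exists R : {mpoly F[k]},
    forall y, R.@[y] = phi (lin_comb e y ^+ s).
  elim: s => [|s IHs] phi.
    by exists (phi 1)%:MP => y; rewrite mevalC expr0.
  have /fin_all_exists[Q QE] i := IHs (phi \o amull (tnth e i))%VF.
  exists (\sum_(i < k) 'X_i * Q i) => y.
  rewrite exprS {1}/lin_comb mulr_suml !raddf_sum.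
  apply: eq_bigr => i _; rewrite /= mevalM mevalXU QE comp_lfunE lfunE /=.
  by rewrite -scalerAl linearZ.
have /fin_all_exists[Q QE] (s : 'I_nu.+1) := powE s omega.
exists (\sum_(s < nu.+1 | (2 <= s)%N) (s`!%:R)^-1 *: Q s) => y.
rewrite /nilpolynomial big_geq_mkord !raddf_sum.
by apply: eq_bigr => s _; rewrite /= mevalZ QE linearZ.
Qed.

(* f(e_1, ..., e_k) *)
Definition eval_alg k (e : k.-tuple A) (f : {mpoly F[k]}) : A :=
  mmap (in_alg A) (tnth e) f.

Definition relations k (e : k.-tuple A) (f : {mpoly F[k]}) : Prop :=
  eval_alg e f = 0.

End Algebra.

Section InverseSystem.
Variables (F : fieldType) (k : nat).
Implicit Types (f g : {mpoly F[k]}).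

(* f(d/dy_1, ..., d/dy_k)(g) *)
Definition diff_op f g : {mpoly F[k]} :=
  \sum_(a <- msupp f) f@_a *: g^`M[a].

(* msize g = deg g + 1 for g <> 0 *)
Definition inverse_system (I : {mpoly F[k]} -> Prop) (nu : nat) g : Prop :=
  msize g = nu.+1 /\ (forall f, diff_op f g = 0 <-> I f).

End InverseSystem.

(* Main.v *)
Require Import Defs.
From HB Require Import structures.
From mathcomp Require Import all_boot all_order all_algebra all_field.
From mathcomp Require Import mpoly.

Set Implicit Arguments.
Unset Strict Implicit.
Unset Printing Implicit Defensive.

Import GRing.Theory.
Local Open Scope ring_scope.

(** For a in A let E(a) be the polynomial y |-> omega(a exp(sum_i y_i e_i)), so
    that R = E(1).  By commutativity d/dy_j E(a) = E(a e_j), hence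
    f(d/dy) R = E(f(e)), and it remains to see that E is injective.  If E(a) = 0,
    the constant terms of its derivatives show that omega kills a L^s for all s;
    as m^s <= L^s + m^(s+1) and m is nilpotent, omega kills a A.  A nonzero ideal
    a A would meet Ann(m), on which omega is injective.  The same argument,
    keeping track of degrees, shows that deg R < nu would make omega vanish on
    m^nu <= Ann(m). *)

(** * Polynomials that vanish at every point *)

Section Vanishing.
Variable F : fieldType.
Hypothesis char0 : [pchar F] =i pred0.

Lemma poly_vanishing (p : {poly F}) : (forall x, p.[x] = 0) -> p = 0.
Proof.
move=> p0; apply/eqP/contraT => /max_poly_roots max_p.
(* The images of 0, ..., [size p] - 1 are distinct in characteristic zero, which is one root too
   many for [p != 0]. *)
suff: (size (map (GRing.natmul (1 : F)) (iota 0 (size p))) < size p)%N.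
  by rewrite size_map size_iota ltnn.
apply: max_p; first by apply/allP => x _; rewrite rootE p0.
rewrite map_inj_uniq ?iota_uniq // => i j.
wlog ij : i j / (i <= j)%N.
  by case: (leqP i j) => [|/ltnW] ij wlg => [|/esym] /wlg -> //.
move/eqP; rewrite eq_sym -subr_eq0 -natrB // ((pcharf0P F).1 char0).
by rewrite subn_eq0 => ji; apply/eqP; rewrite eqn_leq ij.
Qed.

Lemma meval_muni n (p : {mpoly F[n.+1]}) (v : 'I_n.+1 -> F) :
  (map_poly (meval (v \o widen_ord (leqnSn n))) (muni p)).[v ord_max] = p.@[v].
Proof.
rewrite muniE mevalE rmorph_sum horner_sum; apply: eq_bigr => m _.
rewrite /= map_polyZ hornerZ map_polyXn hornerXn /= mevalZ mevalX big_ord_recr /=.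
by rewrite mulrA; congr (_ * _ * _); apply: eq_bigr => i _; rewrite mnmE.
Qed.

(** This provides the injectivity of [muni] for the induction on the number of variables. *)
Lemma muniK n (p : {mpoly F[n.+1]}) :
  (map_poly (@mwiden n F) (muni p)).['X_ord_max] = p.
Proof.
rewrite muniE [RHS]mpolyE rmorph_sum horner_sum; apply: eq_bigr => m _.
rewrite /= map_polyZ hornerZ map_polyXn hornerXn /= mwidenZ mwidenX -scalerAl.
rewrite [in RHS]mpolyXE_id big_ord_recr /= mpolyXE_id big_ord_recr /=.
rewrite mnmwiden_ordmax expr0 mulr1; congr (_ *: (_ * _)); apply: eq_bigr => i _.
by rewrite mnmwiden_widen mnmE.
Qed.

Lemma mpoly_vanishing n (p : {mpoly F[n]}) : (forall v, p.@[v] = 0) -> p = 0.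
Proof.
elim: n p => [|n IHn] p p0.
  suff pE : p = (p@_0)%:MP.
    by have := p0 (fun=> 0); rewrite pE mevalC => ->; rewrite mpolyC0.
  apply/mpolyP => m; rewrite mcoeffC (_ : m = 0%MM) ?eqxx ?mulr1 //.
  by apply/mnmP => -[].
suff p'0 : muni p = 0 by rewrite -[p]muniK p'0 map_poly0 horner0.
(* With the first [n] coordinates frozen at [v'], the polynomial in the last variable has only zero
   values, so each of its coefficients vanishes at [v']. *)
apply/polyP => j; rewrite coef0; apply: IHn => v'.
rewrite -(coef_map (meval v')) /=.
rewrite (poly_vanishing (p := map_poly _ _)) ?coef0 // => x.
pose v i := if unlift ord_max i is Some j then v' j else x.
rewrite -(p0 v) -meval_muni {2}/v unlift_none; congr (_.[_]).
apply: eq_map_poly => q; apply: meval_eq => i; rewrite /v /=.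
have -> : widen_ord (leqnSn n) i = lift ord_max i.
  by apply/val_inj; rewrite /= /bump leqNgt ltn_ord.
by rewrite liftK.
Qed.

End Vanishing.

Lemma mderivXU (R : nzRingType) n (i j : 'I_n) :
  ('X_i : {mpoly R[n]})^`M(j) = (i == j)%:R.
Proof.
rewrite mderivX mnm1E; case: eqP => [->|_]; last by rewrite scale0r.
rewrite scale1r (_ : (U_(j) - U_(j) = 0)%MM) ?mpolyX0 //.
by apply/mnmP => i'; rewrite !mnmE subnn.
Qed.

Lemma msize_mderiv_le (R : nzRingType) n (p : {mpoly R[n]}) j s :
  (msize p <= s.+1)%N -> (msize p^`M(j) <= s)%N.
Proof.
move=> ps; rewrite msizeE; apply/bigmax_leqP_seq => m.
rewrite mcoeff_msupp mcoeff_mderiv => p'm _.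
have: (m + U_(j))%MM \in msupp p.
  by rewrite mcoeff_msupp; apply: contraNneq p'm => ->; rewrite mul0rn.
by move/msize_mdeg_lt/leq_trans => /(_ _ ps); rewrite mdegD mdeg1 addn1.
Qed.

(** * The polynomials E(a) and their derivatives *)

Section ExpForm.
Variables (F : fieldType) (A : falgType F) (k : nat) (e : k.-tuple A).
Variable omega : 'Hom(A, F^o).
Hypothesis mulC : commutative (@GRing.mul A).
Implicit Types (a b : A) (s : nat).

(** This is y |-> omega(a (sum_i y_i e_i)^s). Expanding one factor at a time and absorbing e_i into
    [a] avoids multinomial coefficients. *)
Fixpoint pow_form s a : {mpoly F[k]} :=
  if s is s'.+1 then \sum_(i < k) 'X_i * pow_form s' (a * tnth e i)
  else (omega a : F)%:MP.

Lemma meval_pow_form s a y :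
  (pow_form s a).@[y] = omega (a * lin_comb e y ^+ s).
Proof.
elim: s a => [|s IHs] a /=; first by rewrite mevalC expr0 mulr1.
rewrite exprS mulrA [a * _]mulr_sumr mulr_suml !raddf_sum.
apply: eq_bigr => i _; rewrite /= mevalM mevalXU IHs.
by rewrite -scalerAr -scalerAl linearZ.
Qed.

Lemma pow_form_linear s : linear (pow_form s).
Proof.
elim: s => [|s IHs] c a b /=.
  by rewrite linearP mpolyCD mpolyCM mul_mpolyC.
rewrite scaler_sumr -big_split /=; apply: eq_bigr => i _.
by rewrite mulrDl -scalerAl IHs mulrDr scalerAr.
Qed.

Lemma mderiv_pow_form s a j :
  (pow_form s.+1 a)^`M(j) = s.+1%:R *: pow_form s (a * tnth e j).
Proof.
have leibniz t b : (pow_form t.+1 b)^`M(j) =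
    pow_form t (b * tnth e j) + \sum_i 'X_i * (pow_form t (b * tnth e i))^`M(j).
  rewrite raddf_sum /=; under eq_bigr do rewrite mderivM mderivXU.
  rewrite big_split /= (bigD1 j) //= eqxx mul1r big1 ?addr0 // => i /negPf ->.
  by rewrite mul0r.
elim: s a => [|s IHs] a; rewrite leibniz.
  by rewrite big1 ?addr0 ?scale1r // => i _; rewrite mderivC mulr0.
(* Differentiating the outer 'X_i gives one copy of the form; the induction hypothesis gives [s.+1]
   more, after e_i and e_j are swapped. *)
rewrite [in RHS]mulrS scalerDl scale1r; congr (_ + _).
rewrite scaler_sumr; apply: eq_bigr => i _.
by rewrite IHs scalerAr -!mulrA [tnth e j * _]mulC.
Qed.

Lemma pow_form_eq0 s a :
  (forall x, x \in (<<e>> ^+ s)%VS -> omega (a * x) = 0) -> pow_form s a = 0.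
Proof.
elim: s a => [|s IHs] a a0 /=.
  by rewrite -[a]mulr1 a0 ?expv0 ?memv_line ?mpolyC0.
rewrite big1 // => i _; rewrite IHs ?mulr0 // => x xs.
by rewrite -mulrA a0 // expvSl memv_mul // memv_span ?mem_tnth.
Qed.

Lemma msize_pow_form s a : (msize (pow_form s a) <= s.+1)%N.
Proof.
elim: s a => [|s IHs] a /=; first by rewrite msizeC leq_b1.
apply: leq_trans (msize_sum _ _ _) _.
apply/bigmax_leqP => i _; have [->|Q0] := eqVneq (pow_form s (a * tnth e i)) 0.
  by rewrite mulr0 msize0.
rewrite msizeM ?msizeX ?mdeg1 //; first exact: IHs.
by rewrite -msize_poly_eq0 msizeX mdeg1.
Qed.

(** E(a) cut off after [n] terms; with [n = nu.+1] nothing is lost once [<<e>> ^+ nu.+1 = 0]. *)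
Definition exp_form n a : {mpoly F[k]} :=
  \sum_(s < n) (s`!%:R)^-1 *: pow_form s a.

Lemma exp_form_linear n : linear (exp_form n).
Proof.
move=> c a b; rewrite scaler_sumr -big_split /=; apply: eq_bigr => s _.
by rewrite pow_form_linear scalerDr !scalerA [c * _]mulrC.
Qed.

HB.instance Definition _ n :=
  GRing.isLinear.Build F A {mpoly F[k]} _ (exp_form n) (exp_form_linear n).

Lemma meval_exp_form n a y :
  (exp_form n a).@[y] = \sum_(s < n) (s`!%:R)^-1 * omega (a * lin_comb e y ^+ s).
Proof.
by rewrite raddf_sum; apply: eq_bigr => s _; rewrite /= mevalZ meval_pow_form.
Qed.

Lemma msize_exp_form n a : (msize (exp_form n a) <= n)%N.
Proof.
apply: leq_trans (msize_sum _ _ _) _; apply/bigmax_leqP => s _.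
by rewrite (leq_trans (msizeZ_le _ _)) // (leq_trans (msize_pow_form _ _)).
Qed.

Section Nilpotent.
Variable nu : nat.
Hypothesis nil_e : (<<e>> ^+ nu.+1 = 0)%VS.
Hypothesis char0 : [pchar F] =i pred0.
Local Notation E := (exp_form nu.+1).

Lemma mderiv_exp_form a j : (E a)^`M(j) = E (a * tnth e j).
Proof.
(* The derivative kills the term of degree 0 and shifts the others down, so the right side has an
   extra term of degree [nu]; it vanishes since e_j [<<e>> ^+ nu] lies in [<<e>> ^+ nu.+1 = 0]. *)
rewrite /exp_form big_ord_recl [RHS]big_ord_recr /= raddfD raddf_sum /=.
rewrite mderivZ mderivC scaler0 add0r [pow_form nu _]pow_form_eq0 => [|x xnu].
  rewrite scaler0 addr0; apply: eq_bigr => s _.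
  rewrite mderivZ mderiv_pow_form scalerA factS natrM invfM mulrC mulrA mulfV.
    by rewrite mul1r.
  by rewrite ((pcharf0P F).1 char0).
suff /eqP: tnth e j * x == 0 by rewrite -mulrA => ->; rewrite mulr0 linear0.
by rewrite -memv0 -nil_e expvSl memv_mul // memv_span ?mem_tnth.
Qed.

Lemma mderivm_exp_form a (b : 'X_{1..k}) :
  (E a)^`M[b] = E (a * mmap1 (tnth e) b).
Proof.
rewrite /mderivm /mmap1 [index_enum _]unlock -enumT.
elim: (enum 'I_k) => [|i r IHr] /=; first by rewrite big_nil mulr1.
rewrite big_cons IHr [_ ^+ _ * _]mulC mulrA.
elim: (b i) => [|n IHn] /=; first by rewrite expr0 mulr1.
by rewrite IHn mderiv_exp_form -[in LHS]mulrA exprSr.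
Qed.

Lemma diff_op_exp_form f a : diff_op f (E a) = E (a * eval_alg e f).
Proof.
rewrite /eval_alg /mmap mulr_sumr linear_sum; apply: eq_bigr => b _ /=.
by rewrite mderivm_exp_form mulr_algl -scalerAr linearZ.
Qed.

(** Derivatives of order [s] kill a polynomial of size at most [s]. Those of E(a) are the E(ax),
    with x a product of [s] of the e_i, and E(ax) has constant term omega(ax). *)
Lemma msize_exp_form_omega s a : (msize (E a) <= s)%N ->
  forall x, x \in (<<e>> ^+ s)%VS -> omega (a * x) = 0.
Proof.
suff kills b : (msize (E b) <= s)%N ->
    (<<e>> ^+ s <= lker (omega \o amull b))%VS.
  move=> /kills/subvP le_ker x /le_ker.
  by rewrite memv_ker comp_lfunE lfunE => /eqP.
elim: s b => [|s IHs] b bs.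
  rewrite expv0 -memvE memv_ker comp_lfunE lfunE /= mulr1.
  (* Evaluation at the origin keeps only the term of degree 0, which is [omega b]. *)
  move: bs; rewrite leqn0 msize_poly_eq0 => /eqP /(congr1 (meval (fun=> 0))).
  rewrite meval0 meval_exp_form big_ord_recl expr0 mulr1 invr1 mul1r big1.
    by rewrite addr0 => ->.
  move=> i _; rewrite [lin_comb _ _]big1 ?expr0n ?mulr0 ?linear0 ?mulr0 // => j _.
  by rewrite scale0r.
rewrite expvSl; apply/prodvP => u v /coord_span -> vs.
rewrite mulr_suml memv_suml // => i _; rewrite -scalerAl memvZ //.
have := IHs (b * e`_i); rewrite -(tnth_nth 0) -mderiv_exp_form.
move=> /(_ (msize_mderiv_le _ bs))/subvP/(_ _ vs).
by rewrite !memv_ker !comp_lfunE !lfunE /= mulrA.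
Qed.

End Nilpotent.

End ExpForm.

(** * Powers of m and of a complement to m^2 *)

Lemma expv_generators (F : fieldType) (A : falgType F) (L m : {vspace A}) s :
  (L <= m)%VS -> (m <= L + m ^+ 2)%VS -> (m ^+ s <= L ^+ s + m ^+ s.+1)%VS.
Proof.
move=> Lm mL; elim: s => [|s IHs]; first by rewrite !expv0 addvSl.
(* One factor m becomes L + m^2: the product m^2 m^s is already in m^(s+2), and L m^s is handled by
   induction. *)
rewrite [in X in (X <= _)%VS]expvSl (subv_trans (prodvS mL (subvv _))) //.
rewrite prodvDl subv_add; apply/andP; split; last first.
  by rewrite -expvD add2n addvSr.
rewrite (subv_trans (prodvSr _ IHs)) // prodvDr -expvSl addvS ?subvv //.
by rewrite [in X in (_ <= X)%VS]expvSl prodvSl.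
Qed.

Lemma expv_sub_generated (F : fieldType) (A : falgType F) (L m W : {vspace A}) n :
  (L <= m)%VS -> (m <= L + m ^+ 2)%VS -> (m ^+ n = 0)%VS ->
  (forall s, (L ^+ s <= W)%VS) -> forall s, (m ^+ s <= W)%VS.
Proof.
move=> Lm mL mn0 LW s.
(* Descending induction on the exponent, starting from [m ^+ n = 0]. *)
suff mW r : (m ^+ (n - r) <= W)%VS.
  have [sn|ns] := leqP s n; first by rewrite -(subKn sn) mW.
  by rewrite -(subnK (ltnW ns)) expvD mn0 prodv0 sub0v.
elim: r => [|r IHr]; first by rewrite subn0 mn0 sub0v.
have [rn|] := ltnP r n; last first.
  by rewrite -subn_eq0 subnS => /eqP nr; rewrite nr in IHr *.
rewrite -subnSK // in IHr.
by rewrite (subv_trans (expv_generators _ Lm mL)) // subv_add LW.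
Qed.

(** * Residue field, socle and nondegeneracy of omega *)

Section Gorenstein.
Variables (F : fieldType) (A : falgType F) (m : {vspace A}).
Hypothesis gorA : gorenstein m.

Lemma gorenstein_one_notin : 1 \notin m.
Proof.
have [_ _ [[/prodvP m_ideal m_proper _] _] _] := gorA.
apply/negP => m1; apply: m_proper; apply/eqP; rewrite eqEsubv subvf.
by apply/subvP => x _; rewrite -[x]mulr1 m_ideal // memvf.
Qed.

(* As Ann(m) is one-dimensional and annihilated by m, it is a one-dimensional
   faithful module over the residue field, which is therefore F itself. *)
Lemma gorenstein_decomp x : exists c, x - c%:A \in m.
Proof.
have [mulC _ [[/prodvP m_ideal _ m_max] _] dim_ann] := gorA.
set u := vpick (annihilator m).
have u_ann : u \in annihilator m := memv_pick _.
have u_neq0 : u != 0 by rewrite vpick0 -dimv_eq0 dim_ann.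
have annE : annihilator m = <[u]>%VS.
  by apply/esym/eqP; rewrite eqEdim -memvE u_ann dim_vline u_neq0 dim_ann.
have [um u_m] := annihilatorP _ _ u_ann.
have : u * x \in annihilator m.
  apply/annihilatorP; split=> [|y ym]; first by rewrite mulC m_ideal ?memvf.
  by rewrite [u * x]mulC -mulrA u_m ?mulr0.
rewrite annE => /vlineP[c uxE]; exists c.
(* The annihilator of [u] is an ideal containing [m], proper as [u] is nonzero; maximality makes it
   [m]. *)
suff <- : lker (amull u) = m.
  by rewrite memv_ker lfunE /= mulrBr uxE -scalerAr mulr1 subrr.
have [||//|kerT] := m_max (lker (amull u)).
- apply/prodvP => a y _; rewrite !memv_ker !lfunE /= => /eqP uy0.
  by rewrite mulrA [u * a]mulC -mulrA uy0 mulr0.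
- by apply/subvP => y ym; rewrite memv_ker lfunE /= u_m.
- have := memvf (1 : A); rewrite -kerT memv_ker lfunE /= mulr1.
  by rewrite (negPf u_neq0).
Qed.

(** The point is that [b] lies in [m]: both [b] and [b - c%:A] kill a generator of the socle, which
    forces [c = 0]. *)
Lemma gorenstein_socle b :
  (forall y, y \in m -> b * y = 0) -> b \in annihilator m.
Proof.
move=> bm; apply/annihilatorP; split=> //.
have [_ _ _ dim_ann] := gorA.
have [um u_m] := annihilatorP _ _ (memv_pick (annihilator m)).
have u_neq0 : vpick (annihilator m) != 0 by rewrite vpick0 -dimv_eq0 dim_ann.
have [c bc] := gorenstein_decomp b.
have := u_m _ bc; have [mulC _ _ _] := gorA.
rewrite mulC mulrBl bm // mulr_algl sub0r => /eqP.
rewrite oppr_eq0 scaler_eq0 (negPf u_neq0) orbF => /eqP c0.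
by move: bc; rewrite c0 scale0r subr0.
Qed.

Variables (Pi : {vspace A}) (omega : 'Hom(A, F^o)).
Hypothesis Pi_compl : complementary_in m Pi (annihilator m).
Hypothesis omega_ker : lker omega = (Pi + 1)%VS.

(** An element of [m] in the span of Pi and 1 has no component along 1, so [b] lies in the
    intersection of Pi and Ann(m), which is 0. *)
Lemma omega_socle_eq0 b : b \in annihilator m -> omega b = 0 -> b = 0.
Proof.
move=> b_ann /eqP; rewrite -memv_ker omega_ker.
move=> /memv_addP[p pPi [_ /vlineP[c ->] bE]].
have [Pi_m Pi_ann] := Pi_compl.
have pm : p \in m by rewrite -Pi_m (subvP (addvSl _ _)).
have bm : b \in m by case/annihilatorP: b_ann.
have c1m : c *: 1 \in m by rewrite -[_ *: _](addKr p) -bE addrC memvB.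
have c0 : c = 0.
  apply: contraNeq gorenstein_one_notin => c_neq0.
  by rewrite -[1](scalerK c_neq0) memvZ.
apply/eqP; rewrite -memv0 -Pi_ann memv_cap b_ann andbT.
by rewrite bE c0 scale0r addr0.
Qed.

Lemma omega_nondegenerate n a :
  (m ^+ n = 0)%VS -> (forall x, omega (a * x) = 0) -> a = 0.
Proof.
move=> mn0 a_omega.
(* If [a] kills m^(s+1), then a m^s lies in the socle, where omega is injective, so [a] kills m^s;
   at [s = 0] this reads [a = 0]. *)
have kill s : (forall x, x \in (m ^+ s)%VS -> a * x = 0) -> a = 0.
  elim: s => [|s IHs] ams; first by rewrite -[a]mulr1 ams ?expv0 ?memv_line.
  apply: IHs => x xs; apply: omega_socle_eq0 (a_omega x).
  by apply: gorenstein_socle => y ym; rewrite -mulrA ams // expvSr memv_mul.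
by apply: (kill n) => x; rewrite mn0 memv0 => /eqP ->; rewrite mulr0.
Qed.

End Gorenstein.

(** * Identification of R with E(1), its degree and its annihilator *)

Theorem theorem2p1 (F : fieldType) (A : falgType F) (m : {vspace A})
    (nu k : nat) (Pi L : {vspace A}) (omega : 'Hom(A, F^o))
    (e : k.-tuple A) (R : {mpoly F[k]})
    (char0 : [pchar F] =i pred0)
    (gorA : gorenstein m)
    (dimA : (2 < \dim {:A})%N)
    (nuE : nil_index m nu)
    (kE : k = embedding_dim m)
    (Pi_codim : \dim m = (\dim Pi).+1)
    (Pi_compl : complementary_in m Pi (annihilator m))
    (omega_ker : lker omega = (Pi + 1)%VS)
    (L_Pi : (L <= Pi)%VS)
    (L_dim : \dim L = k)
    (L_compl : complementary_in m L (m ^+ 2)%VS)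
    (e_basis : basis_of L e)
    (RE : in_coordinates (nilpolynomial omega nu) e R) :
  inverse_system (relations e) nu R.
Proof.
have [mulC _ _ _] := gorA.
have mnu0 : (m ^+ nu.+1 = 0)%VS.
  by apply/eqP/contraT => /(proj2 nuE); rewrite ltnn.
have [Lm2 _] := L_compl.
have Lm : (L <= m)%VS by rewrite -Lm2 addvSl.
have mL : (m <= L + m ^+ 2)%VS by rewrite Lm2.
have LE : <<e>>%VS = L := span_basis e_basis.
have expLm s : (L ^+ s <= m ^+ s)%VS.
  by elim: s => // s IHs; rewrite !expvSl prodvS.
have nil_e : (<<e>> ^+ nu.+1 = 0)%VS.
  by apply/eqP; rewrite LE -subv0 -mnu0.
have RexpE : R = exp_form e omega nu.+1 1.
  apply/eqP; rewrite -subr_eq0; apply/eqP/mpoly_vanishing => // y.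
  rewrite mevalB meval_exp_form RE (nilpolynomialE _ omega_ker).
    by apply/eqP; rewrite subr_eq0; apply/eqP/eq_bigr => s _; rewrite mul1r.
  apply: (subvP L_Pi); apply: memv_suml => i _.
  by rewrite memvZ // -LE memv_span ?mem_tnth.
split=> [|f].
  apply/eqP; rewrite eqn_leq RexpE msize_exp_form ltnNge; apply/negP.
  (* A smaller degree would make omega vanish on L^nu, which contains m^nu because m^(nu+1) = 0,
     while m^nu lies in the socle. *)
  move=> /(msize_exp_form_omega mulC nil_e char0); rewrite LE => omegaL.
  have [m_nu _] := nuE; apply/negP: m_nu; rewrite negbK -subv0.
  apply/subvP => x xm; rewrite memv0; apply/eqP.
  apply: (omega_socle_eq0 gorA Pi_compl omega_ker).
    apply: (gorenstein_socle gorA) => y ym; apply/eqP.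
    by rewrite -memv0 -mnu0 expvSr memv_mul.
  have := subvP (expv_generators nu Lm mL) _ xm.
  by rewrite mnu0 addv0 => /omegaL; rewrite mul1r.
rewrite RexpE (diff_op_exp_form omega mulC nil_e char0) mul1r /relations.
split=> [E0|->]; last exact: linear0.
(* The zero polynomial has size at most [t] for every [t], so omega kills f(e) L^t for all [t]. *)
have omegaE s : (m ^+ s <= lker (omega \o amull (eval_alg e f)))%VS.
  apply: (expv_sub_generated Lm mL mnu0) => t; apply/subvP => x xt.
  rewrite memv_ker comp_lfunE lfunE; apply/eqP.
  apply: (msize_exp_form_omega mulC nil_e char0 (s := t)); last by rewrite LE.
  by rewrite E0 msize0.
apply: (omega_nondegenerate gorA Pi_compl omega_ker mnu0) => x.
(* Since A = F1 + m and [m ^+ 0] is only the line F1, the exponents 0 and 1 together cover A. *)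
have [c xc] := gorenstein_decomp gorA x; rewrite -(subrK c%:A x) mulrDr linearD.
have := subvP (omegaE 1%N) _ xc; have := subvP (omegaE 0%N) c%:A.
rewrite expv0 memvZ ?memv_line // !memv_ker !comp_lfunE !lfunE /=.
by move=> /(_ isT)/eqP -> /eqP ->; rewrite addr0.
Qed.
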